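(* There is a function $f(t)=O(t^{5/3})$ such that for every integer $t$ and every $3$-uniform $\tau$-critical hypergraph $H$ with transversal number $\tau(H)=t$, one has $|V(H)|\le \binom{t+2}{2}+f(t)$.
   Context: A hypergraph $H$ is $3$-uniform if every edge has exactly $3$ vertices. The transversal number $\tau(H)$ is the minimum size of a vertex set meeting every edge of $H$. $H$ is $\tau$-critical if $\tau(H-e)<\tau(H)$ for every edge $e$ of $H$. As usual for $\tau$-critical hypergraphs, $H$ has no isolated vertices (every vertex lies in some edge). *)

(* Defs.v *)
From mathcomp Require Import all_boot.
From Stdlib Require Import Reals.
Set Implicit Arguments. Unset Strict Implicit. Unset Printing Implicit Defensive.

(* A hypergraph on the finite vertex type V is a set E of edges (subsets of V). *)
Definition uniform3 (V : finType) (E : {set {set V}}) : Prop :=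
  forall e, e \in E -> #|e| = 3.

Definition no_isolated (V : finType) (E : {set {set V}}) : Prop :=
  forall v : V, exists2 e, e \in E & v \in e.

Definition transversal (V : finType) (E : {set {set V}}) (T : {set V}) : bool :=
  [forall e in E, T :&: e != set0].

(* Transversal number: minimum size of a transversal
   (default #|V| is only reached if no transversal exists, i.e. E has an empty edge). *)
Definition tau (V : finType) (E : {set {set V}}) : nat :=
  \big[minn/#|V|]_(T : {set V} | transversal E T) #|T|.

Definition tau_critical (V : finType) (E : {set {set V}}) : Prop :=
  forall e, e \in E -> tau (E :\ e) < tau E.

(* Main.v *)
(** Each edge [e] has a set [T e] of fewer than [t] vertices that avoids [e] and meets all
    other edges.  Put [d = t^(1/3)].  Uniting [O(t^(2/3))] of the sets [T e] gives a set [S]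
    with [O(t^(5/3))] vertices and [Q] in [S] such that an edge avoiding [Q] has two vertices
    in [S] and every [T e] misses fewer than [d] vertices of [Q].  By Hall's theorem with
    defect, the vertices outside [S] split into a part [C] matched to distinct pairs of
    [S :\: Q], a remainder of size [O(t^2 / d)], and a part [N] whose pairs in [S :\: Q]
    expand by [1 + 1/d].  Expansion forces each [T e] to have [O(d^2)] vertices in [N], so
    that after removing [O(t d^2)] vertices from [N] no edge has two vertices in [N] and the
    rest of [N] is matched to distinct pairs, too.  The skew form of Bollobas' set-pair
    inequality, for sets of sizes [2] and [t + d], bounds the number of matched vertices by
    ['C(t + d + 2, 2)]. *)

From mathcomp Require Import all_boot all_order all_algebra zify.
Set Implicit Arguments. Unset Strict Implicit. Unset Printing Implicit Defensive.
Import GRing.Theory Num.Theory.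

(** * Hall's theorem *)

Section Hall.
Variables A B : finType.
Implicit Types (r : A -> B -> bool) (X Y Z : {set A}).

Definition nbr r Y : {set B} := [set b | [exists a in Y, r a b]].

Lemma nbrP r Y b : reflect (exists2 a, a \in Y & r a b) (b \in nbr r Y).
Proof. by rewrite inE; apply: (iffP existsP) => [[a /andP[]]|[a Ya rab]]; exists a => //; apply/andP. Qed.

(** Induction on [#|X|]. If a nonempty proper subset [Y] is tight, [Y] and [X :\: Y] are matched
    separately, the latter outside [nbr r Y]. Otherwise every such subset has a neighbour to spare,
    so one point may be matched arbitrarily and removed with its partner. *)
Theorem hall r X (b0 : B) :
    (forall Y, Y \subset X -> #|Y| <= #|nbr r Y|) ->
  exists f : A -> B, {in X &, injective f} /\ {in X, forall x, r x (f x)}.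
Proof.
have [n] := ubnP #|X|; elim: n => // n IH in r X * => /ltnSE leXn hallX.
have [/existsP[Y /and3P[pYX Y0 /eqP tY]]|noT] :=
  boolP [exists Y : {set A}, [&& Y \proper X, Y != set0 & #|nbr r Y| == #|Y|]].
  have sYX := proper_sub pYX.
  have [||f1 [inj1 r1]] := IH r Y.
  - exact: leq_trans (proper_card pYX) leXn.
  - by move=> Z sZY; apply: hallX; apply: subset_trans sYX.
  pose r' a b := r a b && (b \notin nbr r Y).
  have [||f2 [inj2 r2]] := IH r' (X :\: Y).
  - apply: leq_trans leXn; rewrite cardsD (setIidPr sYX).
    by have := subset_leq_card sYX; move: Y0; rewrite -card_gt0; lia.
  - move=> Z; rewrite subsetD => /andP[sZX dZY].
    have := hallX (Y :|: Z); rewrite subUset sYX sZX => /(_ isT).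
    rewrite cardsU (_ : Y :&: Z = set0) ?cards0; last first.
      by apply/eqP; rewrite setI_eq0 disjoint_sym.
    suff : nbr r (Y :|: Z) \subset nbr r Y :|: nbr r' Z.
      by move=> /subset_leq_card; have := cardsU (nbr r Y) (nbr r' Z); lia.
    apply/subsetP=> b /nbrP[a]; rewrite !in_setU => aYZ rab.
    have [//|nb] := boolP (b \in nbr r Y); case/orP: aYZ => [aY|aZ].
      by case/negP: nb; apply/nbrP; exists a.
    by apply/nbrP; exists a => //; rewrite /r' rab.
  exists (fun x => if x \in Y then f1 x else f2 x); split.
    move=> x y xX yX; case: ifP => xY; case: ifP => yY.
    - exact: inj1.
    - have /andP[_ /negP nf] : r' y (f2 y) by apply: r2; rewrite inE yY.
      by move=> E; case: nf; rewrite -E; apply/nbrP; exists x => //; apply: r1.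
    - have /andP[_ /negP nf] : r' x (f2 x) by apply: r2; rewrite inE xY.
      by move=> E; case: nf; rewrite E; apply/nbrP; exists y => //; apply: r1.
    - by apply: inj2; rewrite inE ?xY ?yY.
  move=> x xX; case: ifP => xY; first exact: r1.
  by have /andP[] : r' x (f2 x) by apply: r2; rewrite inE xY.
have [->|/set0Pn[x0 x0X]] := eqVneq X set0.
  by exists (fun=> b0); split=> x; rewrite inE.
have /card_gt0P[b /nbrP[_ /set1P-> rx0b]] : 0 < #|nbr r [set x0]|.
  by have := hallX [set x0]; rewrite sub1set x0X cards1 => /(_ isT).
pose r' a b' := r a b' && (b' != b).
have [||f [injf rf]] := IH r' (X :\ x0).
- by move: leXn; rewrite (cardsD1 x0) x0X.
- move=> Z sZ; have [->|Z0] := eqVneq Z set0; first by rewrite cards0.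
  have sZX : Z \subset X by apply: subset_trans sZ (subD1set _ _).
  have pZ : Z \proper X.
    by apply/properP; split=> //; exists x0 => //; apply/negP=> /(subsetP sZ); rewrite !inE eqxx.
  have := hallX Z sZX; rewrite leq_eqVlt => /orP[/eqP tZ|lt].
    by case/negP: noT; apply/existsP; exists Z; rewrite pZ Z0 tZ /=.
  suff sub : nbr r Z :\ b \subset nbr r' Z.
    have := subset_leq_card sub; have := cardsD1 b (nbr r Z).
    by move: lt; case: (b \in _) => /=; clear; lia.
  apply/subsetP=> b'; rewrite in_setD1 => /andP[b'b /nbrP[a aZ rab]].
  by apply/nbrP; exists a => //; rewrite /r' rab.
exists (fun x => if x == x0 then b else f x); split.
  move=> x y xX yX; case: eqP => [->|/eqP xx]; case: eqP => [->|/eqP yy] //.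
  - have /andP[_ /eqP nf] : r' y (f y) by apply: rf; rewrite !inE yy.
    by move=> E; case: nf.
  - have /andP[_ /eqP nf] : r' x (f x) by apply: rf; rewrite !inE xx.
    by move=> E; case: nf.
  - by apply: injf; rewrite !inE ?xx ?yy.
move=> x xX; case: eqP => [->//|/eqP xx].
by have /andP[] : r' x (f x) by apply: rf; rewrite !inE xx.
Qed.
End Hall.

(** Hall's theorem after adding [k] dummy partners related to every point; the points matched to a
    dummy form [X :\: C]. *)
Theorem hall_defect (A B : finType) (r : A -> B -> bool) (X : {set A}) (b0 : B) k :
    (forall Y : {set A}, Y \subset X -> #|Y| <= #|nbr r Y| + k) ->
  exists (C : {set A}) (f : A -> B), [/\ C \subset X, #|X :\: C| <= k,
    {in C &, injective f} & {in C, forall x, r x (f x)}].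
Proof.
move=> hallX.
pose r' (a : A) (s : B + 'I_k) := if s is inl b then r a b else true.
have [|f [injf rf]] := @hall _ _ r' X (inl b0).
  move=> Y sYX; have [->|/set0Pn[y yY]] := eqVneq Y set0; first by rewrite cards0.
  apply: leq_trans (hallX Y sYX) _.
  rewrite -[X in _ + X]card_ord -cardsT -(card_imset (nbr r Y) (@inl_inj _ 'I_k)).
  rewrite -(card_imset [set: 'I_k] (@inr_inj B _)).
  have := cardsU (@inl B 'I_k @: nbr r Y) (@inr B _ @: [set: 'I_k]).
  rewrite (_ : _ :&: _ = set0) ?cards0 ?subn0 => [<-|]; last first.
    apply/setP=> s; rewrite !inE; apply/negP=> /andP[/imsetP[? _ ->] /imsetP[? _]].
    by [].
  apply/subset_leq_card; rewrite subUset; apply/andP; split; apply/subsetP=> s /imsetP[z zY ->].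
    by have /nbrP[a aY rab] := zY; apply/nbrP; exists a.
  by apply/nbrP; exists y.
pose C := [set x in X | if f x is inl _ then true else false].
exists C, (fun x => if f x is inl b then b else b0); split.
- by apply/subsetP=> x; rewrite inE => /andP[].
- have [k0|k_gt0] := posnP k.
    rewrite (_ : _ :\: _ = set0) ?cards0 //; apply/setP=> x; rewrite !inE.
    by case: (x \in X) => //=; case: (f x) => // -[i]; rewrite k0.
  rewrite -[leqRHS]card_ord -cardsT.
  have inj' : {in X :\: C &, injective (fun x => if f x is inr i then i else Ordinal k_gt0)}.
    move=> x y; rewrite !inE => /andP[+ xX] /andP[+ yX]; rewrite xX yX /=.
    case fx: (f x) => [//|i] _; case fy: (f y) => [//|j] _ E.
    by apply: injf => //; rewrite fx fy E.
  by rewrite -(card_in_imset inj'); apply/subset_leq_card/subsetT.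
- move=> x y; rewrite !inE => /andP[xX +] /andP[yX +].
  case fx: (f x) => [b|//] _; case fy: (f y) => [b'|//] _ E.
  by apply: injf => //; rewrite fx fy E.
- move=> x; rewrite inE => /andP[xX]; have := rf x xX.
  by case: (f x).
Qed.

(** * Skew set pairs *)

Lemma card_le_pairs m : #|{: {kl : 'I_m.+1 * 'I_m.+1 | kl.1 <= kl.2}}| = 'C(m.+2, 2).
Proof.
rewrite card_sig -sum1_card.
rewrite (eq_bigl (fun kl : 'I_m.+1 * 'I_m.+1 => true && (kl.1 <= kl.2))) //.
rewrite -(pair_big_dep xpredT (fun k l : 'I_m.+1 => k <= l) (fun _ _ => 1)) /=.
rewrite (exchange_big_dep xpredT) //=.
(* The outer index is now the larger one, [l], which admits [l.+1] values of the smaller. *)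
rewrite -bin2_sum big_mkord (big_ord_recl m.+1) /= add0n.
apply: eq_bigr => l _; rewrite sum1_card /bump /= add1n.
have lm : l.+1 <= m.+1 := ltn_ord l; rewrite -[RHS]card_ord -cardsT -(@card_imset _ _ (widen_ord lm)); last by move=> i j /(congr1 val)/= /val_inj.
apply: eq_card => k; rewrite [LHS]unfold_in /=; apply/idP/imsetP => [kl|[j _ ->]] /=.
  have kl' : k < l.+1 by [].
  by exists (Ordinal kl'); rewrite ?inE //; apply: val_inj.
exact: (ltn_ord j).
Qed.

Section Poly.
Local Open Scope ring_scope.

(* A symmetric polynomial of degree at most [m] in each variable is a combination of
   the [x^k y^l + x^l y^k] with [k <= l <= m]. *)
Lemma symmetric_expansion (q : {poly rat}) (a b : rat) m : (size q <= m.+1)%nat ->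
  q.[a] * q.[b] = \sum_(s : {kl : 'I_m.+1 * 'I_m.+1 | (kl.1 <= kl.2)%nat})
    (a ^+ (val s).1 * b ^+ (val s).2 +
       (if (val s).1 == (val s).2 then 0 else a ^+ (val s).2 * b ^+ (val s).1)) *
    (q`_(val s).1 * q`_(val s).2).
Proof.
move=> sq; rewrite !(horner_coef_wide _ sq) big_distrlr /=.
rewrite pair_big /=.
rewrite (bigID (fun kl : 'I_m.+1 * 'I_m.+1 => (kl.1 <= kl.2)%nat)) /=.
(* Swapping coordinates folds the terms with [kl.1 > kl.2] onto those below the diagonal. *)
rewrite [X in _ + X](reindex (fun kl : 'I_m.+1 * 'I_m.+1 => (kl.2, kl.1))) /=; last first.
  by exists (fun kl => (kl.2, kl.1)) => -[].
transitivity (\sum_(kl : 'I_m.+1 * 'I_m.+1 | (kl.1 <= kl.2)%nat)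
   (a ^+ kl.1 * b ^+ kl.2 + (if kl.1 == kl.2 then 0 else a ^+ kl.2 * b ^+ kl.1)) *
    (q`_kl.1 * q`_kl.2)).
  rewrite [X in _ + X](_ : _ = \sum_(kl : 'I_m.+1 * 'I_m.+1 | (kl.1 <= kl.2)%nat)
     if kl.1 == kl.2 then 0 else a ^+ kl.2 * b ^+ kl.1 * (q`_kl.1 * q`_kl.2)).
    rewrite -big_split /=; apply: eq_bigr => kl _.
    rewrite mulrDl; congr (_ + _); first by rewrite mulrACA mulrC.
    by case: eqP => _ //; rewrite mul0r.
  rewrite [RHS](bigID (fun kl : 'I_m.+1 * 'I_m.+1 => kl.1 == kl.2)) /=.
  rewrite [X in X + _]big1 ?add0r; last by move=> kl /andP[_ ->].
  apply: eq_big => [kl|kl]; first by rewrite -ltnNge ltn_neqAle andbC.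
  rewrite -ltnNge => lt; rewrite (_ : (kl.1 == kl.2) = false); last first.
    by apply/eqP=> E; rewrite E ltnn in lt.
  by rewrite mulrACA mulrC [q`_kl.2 * _]mulrC.
rewrite -[RHS](big_map val (fun=> true) (fun kl : 'I_m.+1 * 'I_m.+1 =>
  (a ^+ kl.1 * b ^+ kl.2 + (if kl.1 == kl.2 then 0 else a ^+ kl.2 * b ^+ kl.1)) *
    (q`_kl.1 * q`_kl.2))) /=.
rewrite -[LHS]big_filter; apply: perm_big; apply: uniq_perm.
- by rewrite filter_uniq ?index_enum_uniq.
- by rewrite map_inj_uniq ?index_enum_uniq //; apply: val_inj.
move=> kl; rewrite mem_filter mem_index_enum andbT.
apply/idP/mapP => [h|[s _ ->]]; last exact: (valP s).
by exists (Sub kl h); rewrite ?mem_index_enum ?SubK.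
Qed.

(* With [g_B (x, y) = \prod_(v in B) (x - v) (y - v)], the matrix of the values
   [g_(B j) (A i)] is triangular with a nonzero diagonal, and it has rank at most the
   dimension ['C(m.+2, 2)] of the space of the [g_B]. *)
Lemma skew_set_pairs_ord (V : finType) n m (A B : 'I_n -> {set V}) :
    (forall i, #|A i| = 2%nat) -> (forall i, (#|B i| <= m)%nat) ->
    (forall i, A i :&: B i = set0) ->
    (forall i j : 'I_n, (i < j)%nat -> A i :&: B j != set0) ->
  (n <= 'C(m.+2, 2))%nat.
Proof.
move=> cA cB dAB iAB.
(* Vertices become distinct rationals, so that [q i] vanishes at [phi v] exactly for [v] in
   [B i]. *)
pose phi (v : V) : rat := (enum_rank v)%:R.
have phi_inj : injective phi.
  by move=> u v /eqP; rewrite eqr_nat => /eqP /val_inj /enum_rank_inj.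
have /fin_all_exists [a /fin_all_exists [b Aab]] :
    forall i, exists u v, A i = [set u; v].
  by move=> i; have /eqP/cards2P[u [v [_ ->]]] := cA i; exists u, v.
pose q i : {poly rat} := \prod_(v <- enum (B i)) ('X - (phi v)%:P).
have sq i : (size (q i) <= m.+1)%nat.
  by rewrite /q size_prod_XsubC -cardE ltnS cB.
have q0 i v : ((q i).[phi v] == 0) = (v \in B i).
  rewrite horner_prod prodf_seq_eq0; apply/hasP/idP => [[u]|vB].
    by rewrite mem_enum /= => uB; rewrite !hornerE subr_eq0 => /eqP/phi_inj ->.
  by exists v; rewrite ?mem_enum // !hornerE subrr eqxx.
pose I := {: {kl : 'I_m.+1 * 'I_m.+1 | (kl.1 <= kl.2)%nat}}.
pose L := \matrix_(i < n, s < #|I|) let kl := val (enum_val s : I) in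
  (phi (a i) ^+ kl.1 * phi (b i) ^+ kl.2 +
    (if kl.1 == kl.2 then 0 else phi (a i) ^+ kl.2 * phi (b i) ^+ kl.1)).
pose R := \matrix_(s < #|I|, j < n) let kl := val (enum_val s : I) in
  ((q j)`_kl.1 * (q j)`_kl.2).
have LR i j : (L *m R) i j = (q j).[phi (a i)] * (q j).[phi (b i)].
  rewrite mxE (symmetric_expansion _ _ (sq j)).
  rewrite (reindex (fun s : 'I_(#|I|) => enum_val s)) /=; last first.
    by exists enum_rank => s _; rewrite ?enum_valK ?enum_rankK.
  by apply: eq_bigr => s _; rewrite !mxE.
have trig : is_trig_mx (L *m R).
  apply/is_trig_mxP => i j ij; rewrite LR; apply/eqP; rewrite mulf_eq0 !q0.
  have /set0Pn[v] := iAB i j ij; rewrite Aab !inE.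
  by case/andP => /orP[] /eqP -> ->; rewrite ?orbT.
have unit : L *m R \in unitmx.
  rewrite unitmxE det_trig // unitfE; apply/prodf_neq0 => i _.
  rewrite LR mulf_neq0 // q0; apply/negP => vB.
    by have /setP/(_ (a i)) := dAB i; rewrite Aab !inE eqxx vB.
  by have /setP/(_ (b i)) := dAB i; rewrite Aab !inE eqxx vB orbT.
rewrite -(card_le_pairs m) -[leqLHS](mxrank_unit unit).
exact: leq_trans (mxrankM_maxl _ _) (rank_leq_col _).
Qed.
End Poly.

(** Sorting [W] by [key] reduces to sequences; ties may be broken arbitrarily, since equal keys give
    the intersection in both directions. *)
Theorem skew_set_pairs (V : finType) (W : {set V}) (A B : V -> {set V}) (key : V -> nat) m :
    {in W, forall x, #|A x| = 2} -> {in W, forall x, #|B x| <= m} ->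
    {in W, forall x, A x :&: B x = set0} ->
    {in W &, forall x y, x != y -> key x <= key y -> A x :&: B y != set0} ->
  #|W| <= 'C(m.+2, 2).
Proof.
move=> cA cB dAB iAB.
pose s := sort (fun x y => key x <= key y) (enum W).
have ss : size s = #|W| by rewrite size_sort -cardE.
have sW x : (x \in s) = (x \in W) by rewrite mem_sort mem_enum.
have [->//|/set0Pn[x0 x0W]] := eqVneq W set0; first by rewrite cards0.
have nW (i : 'I_#|W|) : nth x0 s i \in W by rewrite -sW mem_nth // ss.
apply: (@skew_set_pairs_ord V _ m (fun i : 'I_#|W| => A (nth x0 s i)) (fun i => B (nth x0 s i))).
- by move=> i; apply: cA.
- by move=> i; apply: cB.
- by move=> i; apply: dAB.
move=> i j ij; apply: iAB => //.
  rewrite nth_uniq ?ss // ?sort_uniq ?enum_uniq //.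
  by rewrite neq_ltn ij.
pose le_key x y := key x <= key y.
have le_key_trans : transitive le_key by move=> y x z; apply: leq_trans.
have le_key_refl : reflexive le_key by move=> x; apply: leqnn.
have srt : sorted le_key s by apply: sort_sorted => x y; apply: leq_total.
by apply: (sorted_leq_nth le_key_trans le_key_refl x0 srt); rewrite ?inE ?ss // ltnW.
Qed.

(** * Matchings and representatives *)

Lemma card_bigcup_le (I V : finType) (A : {set I}) (F : I -> {set V}) k :
  {in A, forall i, #|F i| <= k} -> #|\bigcup_(i in A) F i| <= #|A| * k.
Proof.
move=> Fk; apply: (@leq_trans (\sum_(i in A) #|F i|)).
  elim/big_rec2: _ => [|i n U iA le]; first by rewrite cards0.
  by rewrite cardsU; lia.
by rewrite -sum_nat_const; apply: leq_sum.
Qed.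

(* [G :\: P] is a maximiser of [d.+1 * #|D| - d * #|nbr D|]: optimality against larger sets
   is the expansion of [P], optimality against smaller sets is Hall's condition with defect. *)
Lemma expander_split (A B : finType) (r : A -> B -> bool) (X : {set A}) (G : {set B}) (b0 : B) d :
  exists (C N : {set A}) (P : {set B}) (p : A -> B),
  [/\ [/\ C \subset X, N \subset X, [disjoint C & N] & P \subset G],
      {in C &, injective p} /\ {in C, forall c, [/\ r c (p c), p c \in G & p c \notin P]},
      forall x g, x \in N -> g \in G -> r x g -> g \in P,
      forall P' : {set B}, P' \subset P ->
        d.+1 * #|P'| <= d * #|[set x in N | [exists g in P', r x g]]| &
      d * #|X :\: (C :|: N)| <= #|C|].
Proof.
pose nb (D : {set B}) := [set x in X | [exists g in D, r x g]].
(* Up to the constant [d * #|X|] this is [d.+1 * #|D| - d * #|nb D|], written with a complement to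
   avoid truncated subtraction. *)
pose phi (D : {set B}) := d.+1 * #|D| + d * #|X :\: nb D|.
have P0 : (set0 : {set B}) \subset G by apply: sub0set.
case: (@arg_maxnP _ (set0 : {set B}) (fun D => D \subset G) phi P0) => D sDG maxD.
set N := X :\: nb D.
have nbX D' : nb D' \subset X by apply/subsetP=> x; rewrite inE => /andP[].
pose r1 x g := r x g && (g \in D).
pose k := #|nb D| %/ d.+1.
have [Y sY|C [p [sC cC injp rp]]] := @hall_defect _ _ r1 (nb D) b0 k.
  (* Deleting the neighbours of [Y] from [D] frees [Y] from [nb]. Maximality gives
     [d * #|Y| <= d.+1 * #|nbr r1 Y|], and adding [#|Y| <= #|nb D|] bounds the defect by [k]. *)
  have sub : N :|: Y \subset X :\: nb (D :\: nbr r1 Y).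
    apply/subsetP=> x; rewrite in_setU => xNY; rewrite in_setD.
    have xX : x \in X.
      by case/orP: xNY => [|/(subsetP sY)/(subsetP (nbX _))] //; rewrite inE => /andP[].
    rewrite xX andbT; apply/negP; rewrite inE xX /= => /existsP[g /andP[]].
    rewrite in_setD => /andP[/negP gY gD] rxg; case/orP: xNY => [|xY].
      rewrite in_setD => /andP[/negP nx _]; apply: nx.
      by rewrite inE xX; apply/existsP; exists g; rewrite gD.
    by case: gY; apply/nbrP; exists x => //; rewrite /r1 rxg.
  have sD : nbr r1 Y \subset D by apply/subsetP=> g /nbrP[x _ /andP[]].
  have := maxD (D :\: nbr r1 Y); rewrite (subset_trans (subsetDl _ _) sDG) => /(_ isT).
  rewrite /phi -/N => maxY.
  have dNY : #|N :|: Y| = #|N| + #|Y|.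
    rewrite cardsU (_ : N :&: Y = set0) ?cards0 ?subn0 //.
    apply/setP=> x; rewrite !in_setI in_setD [RHS]inE; apply/negP=> /andP[/andP[/negP nx _] xY].
    by apply: nx; apply: (subsetP sY).
  have := subset_leq_card sub; rewrite dNY.
  have := cardsD D (nbr r1 Y); rewrite (setIidPr sD).
  have := subset_leq_card sD; have := subset_leq_card sY.
  rewrite /k; move: maxY; set a := #|D|; set b := #|nbr r1 Y|; set c := #|D :\: _|.
  set u := #|X :\: _|; set n := #|N|; set y := #|Y|; set z := #|nb D| => h1 h2 h3 h4 h5.
  have h6 : d.+1 * y <= d.+1 * b + z.
    have : d * (n + y) <= d * u by rewrite leq_mul2l h5 orbT.
    move: h1; rewrite h4 mulnBr mulnDr.
    have : d.+1 * b <= d.+1 * a by rewrite leq_mul2l h3 orbT.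
    by lia.
  rewrite -leq_subLR leq_divRL // mulnC mulnBr; lia.
exists C, N, (G :\: D), p; split.
- split; [by apply: subset_trans (nbX D)|exact: subsetDl| |exact: subsetDl].
  rewrite disjoint_sym; apply/pred0P=> x /=; apply/negP=> /andP[].
  by rewrite in_setD => /andP[/negP nx _] /(subsetP sC).
- split=> // c /rp /andP[rc pD]; split=> //; first exact: (subsetP sDG).
  by rewrite in_setD pD.
- move=> x g; rewrite /N in_setD => /andP[nx xX] gG rxg; rewrite in_setD gG andbT.
  apply: contra nx => gD; rewrite inE xX /=; apply/existsP; exists g.
  by rewrite gD.
- move=> P' sP'; have := maxD (D :|: P'); rewrite subUset sDG.
  rewrite (subset_trans sP' (subsetDl _ _)) => /(_ isT); rewrite /phi -/N.
  set M := [set x in N | _].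
  have -> : X :\: nb (D :|: P') = N :\: M.
    apply/setP=> x.
    have ex : [exists g in D :|: P', r x g] = [exists g in D, r x g] || [exists g in P', r x g].
      apply/existsP/orP => [[g /andP[]]|[]/existsP[g /andP[gD rxg]]].
      - by rewrite in_setU => /orP[gD|gD] rxg; [left|right]; apply/existsP; exists g; rewrite gD.
      - by exists g; rewrite in_setU gD.
      - by exists g; rewrite in_setU gD orbT.
    rewrite /M /N in_setD [x \in nb _]inE ex [RHS]in_setD [x \in [set _ in _ | _]]inE.
    rewrite in_setD [x \in nb _]inE.
    by case: (x \in X); case: [exists g in D, r x g]; case: [exists g in P', r x g].
  have sM : M \subset N by apply/subsetP=> x; rewrite inE => /andP[].
  have := cardsD N M; rewrite (setIidPr sM); have := subset_leq_card sM.
  have -> : #|D :|: P'| = #|D| + #|P'|.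
    rewrite cardsU (_ : D :&: P' = set0) ?cards0 ?subn0 //.
    apply/setP=> g; rewrite !in_setI [RHS]inE; apply/negP=> /andP[gD /(subsetP sP')].
    by rewrite in_setD gD.
  move: #|D| #|P'| #|N| #|M| #|_ :\: _| => a b n m u h1 -> h2.
  have : d * m <= d * n by rewrite leq_mul2l h1 orbT.
  by move: h2; rewrite mulnBr mulnDr; lia.
have -> : X :\: (C :|: N) = nb D :\: C.
  apply/setP=> x; rewrite !in_setD in_setU negb_or in_setD -andbA; congr (_ && _).
  case xX: (x \in X); first by rewrite !andbT negbK.
  by rewrite andbF; apply/esym/negP=> /(subsetP (nbX _)); rewrite xX.
(* [C] misses at most a fraction 1/(d+1) of [nb D], that is, at most [#|C| / d] points. *)
have := cardsD (nb D) C; rewrite (setIidPr sC); have := subset_leq_card sC.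
move: cC; rewrite /k leq_divRL // => h1 h2 h3.
by move: h1; rewrite h3 mulnS; lia.
Qed.

Lemma greedy_representatives (V : finType) (s : seq V) (p : V -> {set V}) (U : {set V}) :
    uniq s -> {in s, forall c, c \notin U} -> {in s &, forall c c', c \notin p c'} ->
    {in s, forall c, p c != set0} ->
  exists rho : V -> V,
  [/\ {in s, forall c, rho c \notin U}, {in s &, injective rho},
      {in s, forall c, rho c = c \/ rho c \in p c} &
      {in s, forall c, exists2 v, v \in p c &
        v \in U \/ exists2 c', c' \in s & index c' s <= index c s /\ rho c' = v}].
Proof.
elim/last_ind: s => [|s c IH] => [_ _ _ _|]; first by exists (fun x => x); split.
rewrite rcons_uniq => /andP[cs us] sU sp p0.
have ss x : x \in s -> x \in rcons s c by move=> xs; rewrite mem_rcons inE xs orbT.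
have c_in : c \in rcons s c by rewrite mem_rcons inE eqxx.
have [|||rho [rU rinj rp rc]] := IH us.
- by move=> x /ss; apply: sU.
- by move=> x y /ss xs /ss ys; apply: sp.
- by move=> x /ss; apply: p0.
pose U' := U :|: [set rho x | x in s].
pose v := odflt c [pick u in p c :\: U'].
have vU : v \notin U'.
  rewrite /v; case: pickP => [u|_] /=; first by rewrite in_setD => /andP[].
  (* [c] itself is still free: an earlier representative lies in [s] or in some [p x], and no [p x]
     contains [c]. *)
  rewrite in_setU negb_or sU //=; apply/imsetP=> -[x xs E].
  case: (rp x xs) => [E'|]; first by case/negP: cs; rewrite E E'.
  by rewrite -E; apply/negP/sp => //; apply: ss.
exists (fun x => if x == c then v else rho x).
have nc x : x \in s -> (x == c) = false by move=> xs; apply/eqP=> E; rewrite -E xs in cs.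
have idx x : x \in s -> index x (rcons s c) = index x s by move=> xs; rewrite -cats1 index_cat xs.
have v_new x : x \in s -> v <> rho x.
  by move=> xs E; case/negP: vU; rewrite in_setU E; apply/orP; right; apply: imset_f.
split.
- move=> x; rewrite mem_rcons inE => /orP[/eqP->|xs]; last by rewrite nc // rU.
  by rewrite eqxx; move: vU; rewrite in_setU negb_or => /andP[].
- move=> x y; rewrite !mem_rcons !inE => /orP[/eqP->|xs] /orP[/eqP->|ys] //; rewrite ?eqxx ?nc //.
  + by move/v_new => /(_ ys).
  + by move/esym/v_new => /(_ xs).
  + exact: rinj.
- move=> x; rewrite mem_rcons inE => /orP[/eqP->|xs]; last by rewrite nc //; apply: rp.
  rewrite eqxx /v; case: pickP => [u|_] /=; last by left.
  by rewrite in_setD => /andP[]; right.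
move=> x; rewrite mem_rcons inE => /orP[/eqP->{x}|xs]; last first.
  have [u ux [uU|[c' c's [ic' E]]]] := rc x xs; exists u => //; first by left.
  by right; exists c'; rewrite ?ss // !idx // nc.
have idc : index c (rcons s c) = size s.
  by rewrite -cats1 index_cat (negbTE cs) /= eqxx addn0.
have [vp|vp] := boolP (v \in p c).
  by exists v => //; right; exists c => //; rewrite eqxx.
have /set0Pn[u uc] := p0 c c_in; exists u => //.
have : u \in U'.
  apply: contraR vp => uU; rewrite /v; case: pickP => [u'|/(_ u)] /=.
    by rewrite in_setD => /andP[].
  by rewrite in_setD uU uc.
rewrite in_setU => /orP[|/imsetP[x xs E]]; first by left.
right; exists x; first exact: ss.
by rewrite idc idx // nc // ltnW // index_mem.
Qed.

(** * Critical hypergraphs *)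

Section Critical.
Variables (V : finType) (E : {set {set V}}) (t : nat) (T : {set V} -> {set V}).
Hypothesis E3 : {in E, forall e : {set V}, #|e| = 3}.
Hypothesis covE : forall v, exists2 e, e \in E & v \in e.
Hypothesis card_T : {in E, forall e : {set V}, #|T e| < t}.
Hypothesis T_meets : {in E &, forall e f : {set V}, f != e -> exists2 v, v \in T e & v \in f}.
Hypothesis T_avoids : {in E, forall (e : {set V}) v, v \in e -> v \notin T e}.
Hypothesis t_min : forall U : {set V}, {in E, forall e : {set V}, exists2 v, v \in U & v \in e} -> t <= #|U|.
Variable T0 : {set V}.
Hypothesis card_T0 : #|T0| <= t.
Hypothesis T0_meets : {in E, forall e : {set V}, exists2 v, v \in T0 & v \in e}.

(** The link of [x], used as the relation for Hall's theorem. *)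
Definition adj (x : V) (g : {set V}) := (x \notin g) && (x |: g \in E).

Lemma adj_card x g : adj x g -> #|g| = 2.
Proof. by case/andP=> xg /E3; rewrite cardsU1 xg => -[]. Qed.

Lemma adj_del x e : e \in E -> x \in e -> adj x (e :\ x).
Proof. by move=> eE xe; rewrite /adj setD11 setD1K. Qed.

(* Traces of the edges served by [T e] inside [M] may replace that part of [T e]. *)
Lemma exchange e (M D : {set V}) (P : {set {set V}}) :
    e \in E -> {in P, forall g : {set V}, g != set0} ->
    {in E, forall f : {set V}, {in f, forall v, v \in T e -> v \in M} ->
      (exists2 v, v \in D & v \in f) \/ (exists2 g, g \in P & g \subset f)} ->
  t <= #|T e :\: M| + #|D| + #|P|.
Proof.
move=> eE P0 cov.
have [v0 _ _] : exists2 v, v \in T0 & v \in e by apply: T0_meets.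
(* One vertex is chosen from each member of [P]; [v0] is a mere default. *)
pose rep (g : {set V}) := odflt v0 [pick v in g].
have repP g : g \in P -> rep g \in g.
  move=> /P0 /set0Pn[u ug]; rewrite /rep; case: pickP => [//|/(_ u)].
  by rewrite ug.
apply: (@leq_trans #|T e :\: M :|: D :|: rep @: P|); last first.
  rewrite cardsU; apply: leq_trans (leq_subr _ _) _; apply: leq_add; last exact: leq_imset_card.
  by rewrite cardsU leq_subr.
apply: t_min => f fE.
have [/existsP[v /and3P[vf vT vM]]|h] := boolP [exists v, [&& v \in f, v \in T e & v \notin M]].
  by exists v => //; rewrite !in_setU in_setD vM vT.
have [v vf vT|[v vD vf]|[g gP gf]] := cov f fE.
- by apply: contraR h => vM; apply/existsP; exists v; rewrite vf vT.
- by exists v => //; rewrite !in_setU vD orbT.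
- exists (rep g); last exact: (subsetP gf) (repP g gP).
  by rewrite in_setU imset_f ?orbT.
Qed.

(* As long as some [T f] misses [d] vertices of [Q], add [T f] and [f] to [S] and replace
   [Q] by [Q :&: T f]: an edge that leaves [Q] this way meets [S] in two vertices. *)
Lemma separating_core d : 0 < d -> exists S Q : {set V},
  [/\ Q \subset S, #|Q| <= t, #|S| * d <= t * d + (t + 2) * t,
      {in E, forall e : {set V}, [disjoint e & Q] -> 1 < #|e :&: S|} &
      {in E, forall e : {set V}, #|Q :\: T e| < d}].
Proof.
move=> d0.
(* A round removes at least [d] vertices from [Q] and adds at most [t + 2] to [S]: fewer than [t]
   from [T f] and three from [f]. This keeps the weighted bound on [#|S|] invariant. *)
suff gen n (S Q : {set V}) : #|Q| <= n -> Q \subset S -> #|Q| <= t ->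
    #|S| * d <= t * d + (t + 2) * (t - #|Q|) ->
    {in E, forall e : {set V}, [disjoint e & Q] -> 1 < #|e :&: S|} ->
    exists S Q : {set V},
      [/\ Q \subset S, #|Q| <= t, #|S| * d <= t * d + (t + 2) * t,
          {in E, forall e : {set V}, [disjoint e & Q] -> 1 < #|e :&: S|} &
          {in E, forall e : {set V}, #|Q :\: T e| < d}].
  apply: (gen #|T0| T0 T0) => //.
    by apply: leq_trans (leq_addr _ _); rewrite leq_mul2r card_T0 orbT.
  move=> e eE /pred0P dis; have [v vT ve] := T0_meets eE.
  by have := dis v; rewrite /= ve vT.
elim: n S Q => [|n IH] S Q cQ sQS Qt cS core.
  exists S, Q; split=> //.
    by apply: leq_trans cS _; rewrite leq_add2l leq_mul2l leq_subr orbT.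
  move=> e _; move: cQ; rewrite leqn0 cards_eq0 => /eqP ->.
  by rewrite set0D cards0.
have [/existsP[f /andP[fE le_d]]|h] := boolP [exists f in E, d <= #|Q :\: T f|]; last first.
  exists S, Q; split=> //.
    by apply: leq_trans cS _; rewrite leq_add2l leq_mul2l leq_subr orbT.
  move=> e eE; rewrite ltnNge; apply: contra h => le_d.
  by apply/existsP; exists e; rewrite eE.
have cQ' := cardsID (T f) Q.
apply: (IH (S :|: T f :|: f) (Q :&: T f)).
- lia.
- by apply: subset_trans (subsetIl _ _) _; rewrite -setUA subsetU // sQS.
- lia.
- have cS' : #|S :|: T f :|: f| <= #|S| + (t + 2).
    have := card_T fE; have := E3 fE; rewrite !cardsU; lia.
  have : #|S :|: T f :|: f| * d <= (#|S| + (t + 2)) * d by rewrite leq_mul2r cS' orbT.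
  rewrite mulnDl => h1.
  have h2 : (t + 2) * d <= (t + 2) * (#|Q| - #|Q :&: T f|) by rewrite leq_mul2l; lia.
  have -> : t - #|Q :&: T f| = (t - #|Q|) + (#|Q| - #|Q :&: T f|) by lia.
  rewrite mulnDr; lia.
move=> e eE disj.
have [/(core e eE) h1|] := boolP [disjoint e & Q].
  apply: leq_trans h1 _; apply: subset_leq_card; apply: setIS.
  by rewrite -setUA subsetUl.
(* The edge left [Q] in this round: it meets the new [S] in [q], outside [T f], and again in [T f],
   unless it is [f] itself, which lies wholly in the new [S]. *)
rewrite -setI_eq0 => /set0Pn[q]; rewrite in_setI => /andP[qe qQ].
have qT : q \notin T f.
  by apply/negP=> qT; have /pred0P/(_ q) := disj; rewrite /= qe in_setI qQ qT.
have [->|ef] := eqVneq e f.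
  by rewrite (setIidPl _) ?E3 // subsetUr.
have [v vT ve] := T_meets fE eE ef.
have <- : #|[set q; v]| = 2.
  by rewrite cards2; case: eqP => // E'; rewrite E' vT in qT.
apply: subset_leq_card; rewrite subUset !sub1set !in_setI !in_setU qe ve vT.
by rewrite (subsetP sQS) // !orbT.
Qed.

(** Let [Pe] be the members of [P] that [T e] misses. By [exchange], [Q :\: T e], a vertex of [e]
    and one vertex per member of [Pe] can replace [T e :&: N], which thus has fewer than [#|Pe| + d]
    vertices. A vertex of [N] adjacent to [Pe] lies in [T e] or in [e], so expansion bounds [#|Pe|]
    by [d * d + 2 * d]. *)
Lemma few_in_expanding_part d (S Q N : {set V}) (P : {set {set V}}) e :
    [disjoint N & S] -> Q \subset S ->
    {in E, forall e : {set V}, [disjoint e & Q] -> 1 < #|e :&: S|} ->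
    (forall x (g : {set V}), x \in N -> g \subset S :\: Q -> adj x g -> g \in P) ->
    (forall g : {set V}, g \in P -> g != set0) ->
    (forall P' : {set {set V}}, P' \subset P ->
        d.+1 * #|P'| <= d * #|[set x in N | [exists g in P', adj x g]]|) ->
    e \in E -> #|Q :\: T e| < d ->
  #|T e :&: N| <= d * d + 3 * d.
Proof.
move=> dNS sQS core toP P0 expand eE De.
have NS x : x \in N -> x \notin S.
  by move=> xN; apply/negP=> xS; have /pred0P/(_ x) := dNS; rewrite /= xN xS.
pose Pe : {set {set V}} := [set g in P | [disjoint g & T e]].
have sPe : Pe \subset P by apply/subsetP=> g; rewrite inE => /andP[].
have [v0 _ v0e] := T0_meets eE.
have ex : t <= #|T e :\: N| + #|v0 |: (Q :\: T e)| + #|Pe|.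
  apply: exchange => // [g /(subsetP sPe)/P0//|f fE fTN].
  have [->|fe] := eqVneq f e.
    by left; exists v0 => //; rewrite in_setU1 eqxx.
  have [x xT xf] := T_meets eE fE fe.
  have xN := fTN x xf xT.
  have [disj|] := boolP [disjoint f & Q]; last first.
    rewrite -setI_eq0 => /set0Pn[q]; rewrite in_setI => /andP[qf qQ].
    left; exists q => //; rewrite in_setU1 in_setD qQ andbT.
    suff -> : q \notin T e by rewrite orbT.
    by apply/negP=> /(fTN q qf)/NS; rewrite (subsetP sQS).
  (* [f] has two vertices in [S] and [x] is outside [S], so [f :\ x] is a pair in [S]. *)
  have f2 := core f fE disj.
  right; exists (f :\ x); last exact: subD1set.
  have fS : f :\ x \subset S.
    have s1 : f :&: S \subset f :\ x.
      apply/subsetP=> u; rewrite in_setI in_setD1 => /andP[-> uS]; rewrite andbT.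
      by apply: contraTneq uS => ->; apply: NS.
    have : f :&: S == f :\ x.
      by rewrite eqEcard s1 /=; move: f2; have := cardsD1 x f; rewrite E3 // xf; clear; lia.
    by move/eqP <-; apply: subsetIr.
  rewrite inE; apply/andP; split.
    apply: (toP x) => //; last exact: adj_del.
    by rewrite subsetD fS (disjointWl (subD1set _ _) disj).
  apply/pred0P=> u /=; apply/negP=> /andP[ufx uT].
  have uS := subsetP fS u ufx; move: ufx; rewrite in_setD1 => /andP[_ uf].
  by have := NS _ (fTN u uf uT); rewrite uS.
have sub : [set x in N | [exists g in Pe, adj x g]] \subset (T e :&: N) :|: e.
  apply/subsetP=> x; rewrite inE => /andP[xN /existsP[g /andP[]]].
  rewrite inE => /andP[gP gT] /andP[xg xgE]; rewrite in_setU in_setI xN andbT.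
  have [<-|ne] := eqVneq (x |: g) e; first by rewrite setU11 orbT.
  have [u uT] := T_meets eE xgE ne; rewrite in_setU1 => /orP[/eqP <-|ug]; first by rewrite uT.
  by have /pred0P/(_ u) := gT; rewrite /= ug uT.
have := expand Pe sPe; have := subset_leq_card sub; have := cardsU (T e :&: N) e.
rewrite (E3 eE); have := cardsID N (T e); have := card_T eE.
have := cardsU1 v0 (Q :\: T e); move: ex De.
set a := #|T e :\: N|; set b := #|T e :&: N|; set c := #|Pe|; set q := #|Q :\: T e|.
set y := #|[set x in N | _]|; set z := #|T e :&: N :|: e|; set u := #|v0 |: (Q :\: T e)| => h1 h2 h3 h4 h5 h6 h7 h8.
have hb : b < c + d by case: (v0 \notin _) h3; lia.
have : d * y <= d * (c + d + 2) by rewrite leq_mul2l; lia.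
rewrite !mulnDr; lia.
Qed.

(* In a minimal violator of Hall's condition, [exchange] would produce a transversal
   with fewer than [t] vertices. *)
Lemma sparse_matching (M : {set V}) :
    {in E, forall e : {set V}, #|e :&: M| <= 1} ->
  exists pi : V -> {set V}, {in M &, injective pi} /\ {in M, forall x, adj x (pi x)}.
Proof.
move=> sparse; apply: (hall set0).
have sp e x y : e \in E -> x \in e -> y \in e -> x \in M -> y \in M -> x = y.
  move=> eE xe ye xM yM; apply/eqP; apply/negPn/negP => xy.
  have := sparse e eE; rewrite leqNgt => /negP; apply.
  have <- : #|[set x; y]| = 2 by rewrite cards2 xy.
  by apply: subset_leq_card; rewrite subUset !sub1set !in_setI xe ye xM yM.
suff /forallP all_ok : [forall Y : {set V}, (Y \subset M) ==> (#|Y| <= #|nbr adj Y|)].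
  by move=> Y sYM; have /implyP/(_ sYM) := all_ok Y.
apply/negPn/negP => /forallPn[Y1]; rewrite negb_imply -ltnNge => bad1.
pose bad (Y : {set V}) := (Y \subset M) && (#|nbr adj Y| < #|Y|).
have {}bad1 : bad Y1 by [].
case: (@arg_minnP _ Y1 bad (fun Y : {set V} => #|Y|) bad1) => Y /andP[sYM lt] minY.
have /card_gt0P[x xY] : 0 < #|Y| by apply: leq_trans lt.
have [e eE xe] := covE x.
pose Pe : {set {set V}} := [set g in nbr adj Y | [disjoint g & T e]].
pose Y' := [set y in Y | [exists g in Pe, adj y g]].
have ePe : e :\ x \in Pe.
  rewrite inE; apply/andP; split; first by apply/nbrP; exists x => //; apply: adj_del.
  apply/pred0P=> u /=; apply/negP=> /andP[]; rewrite in_setD1 => /andP[_ ue].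
  exact/negP/T_avoids.
have xY' : x \in Y'.
  by rewrite inE xY; apply/existsP; exists (e :\ x); rewrite ePe adj_del.
have ex : t <= #|T e :\: Y| + #|(set0 : {set V})| + #|Pe|.
  apply: exchange => // [g|f fE fTY].
    by rewrite inE => /andP[/nbrP[y _ /adj_card g2] _]; rewrite -card_gt0 g2.
  right; have [->|fe] := eqVneq f e; first by exists (e :\ x); rewrite ?subD1set.
  have [y yT yf] := T_meets eE fE fe; have yY := fTY y yf yT.
  exists (f :\ y); last exact: subD1set.
  rewrite inE; apply/andP; split; first by apply/nbrP; exists y => //; apply: adj_del.
  apply/pred0P=> u /=; apply/negP=> /andP[]; rewrite in_setD1 => /andP[/eqP uy uf] uT.
  by apply: uy; apply: (sp f) => //; apply: (subsetP sYM) => //; apply: fTY.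
have sub : Y' \subset x |: (T e :&: Y).
  apply/subsetP=> y; rewrite inE => /andP[yY /existsP[g /andP[]]].
  rewrite inE => /andP[_ gT] /andP[yg ygE]; rewrite in_setU1 in_setI yY andbT.
  have [E'|ne] := eqVneq (y |: g) e.
    by rewrite (sp e y x) ?eqxx // -?E' ?setU11 // (subsetP sYM).
  have [u uT] := T_meets eE ygE ne; rewrite in_setU1 => /orP[/eqP <-|ug]; first by rewrite uT orbT.
  by have /pred0P/(_ u) := gT; rewrite /= ug uT.
have sY' : Y' \subset Y by apply/subsetP=> y; rewrite inE => /andP[].
have cY' := cardsD Y Y'; rewrite (setIidPr sY') in cY'.
have gt0 : 0 < #|Y'| by apply/card_gt0P; exists x.
have leY' := subset_leq_card sY'.
(* By minimality [Y :\: Y'] satisfies Hall's condition, and its neighbourhood loses all of [Pe].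
   Hence [#|Pe| < #|Y'| <= #|T e :&: Y| + 1], which contradicts [ex]. *)
have : ~~ bad (Y :\: Y').
  by apply/negP=> /minY; rewrite cY'; move: gt0 leY'; clear; lia.
rewrite negb_and (subset_trans (subsetDl _ _) sYM) /= -leqNgt => ok.
have sub2 : nbr adj (Y :\: Y') \subset nbr adj Y :\: Pe.
  apply/subsetP=> g /nbrP[y]; rewrite in_setD => /andP[/negP yY' yY] yg.
  rewrite in_setD; apply/andP; split; last by apply/nbrP; exists y.
  apply/negP=> gPe; apply: yY'; rewrite inE yY; apply/existsP; exists g.
  by rewrite gPe.
have sPe : Pe \subset nbr adj Y by apply/subsetP=> g; rewrite inE => /andP[].
have := subset_leq_card sub2; have := cardsD (nbr adj Y) Pe; rewrite (setIidPr sPe).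
have := subset_leq_card sPe; have := subset_leq_card sub; rewrite cardsU1.
have := cardsID Y (T e); have := card_T eE; move: ex; rewrite cards0.
move: ok lt cY' leY'; move: #|nbr adj (_ :\: _)| #|nbr adj Y :\: Pe| #|Pe| #|nbr adj Y| => n1 n2 n3 n4.
move: #|Y :\: Y'| #|Y'| #|Y| #|T e :\: Y| #|T e :&: Y| #|T e| => n5 n6 n7 n8 n9 n10.
by case: (x \notin _); clear; lia.
Qed.

(* The vertices of [M] whose edge [{x, q, c}] runs through [C] come last in the skew order
   (by [key]).  For them [c] is replaced, in the pair and in [T (eps q)], by [rho q c], which
   is a vertex of [p c] unless earlier representatives already meet [p c]: so a single
   vertex serves both the pair [p c] and the pair of [x]. *)
Lemma two_level_count d (S Q C M : {set V}) (p pi eps : V -> {set V}) :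
    Q \subset S ->
    {in E, forall e : {set V}, [disjoint e & Q] -> 1 < #|e :&: S|} ->
    {in E, forall e : {set V}, #|Q :\: T e| < d} ->
    {in C, forall c, c \notin S} -> {in M, forall x, x \notin S} ->
    {in C &, injective p} -> {in C, forall c, adj c (p c) /\ p c \subset S :\: Q} ->
    {in M &, injective pi} -> {in M, forall x, adj x (pi x)} ->
    {in C, forall c, c \notin M} -> (forall c x, c \in C -> x \in M -> p c != pi x) ->
    {in E, forall e : {set V}, #|e :&: M| <= 1} ->
    {in Q, forall q, eps q \in E /\ q \in eps q} ->
    (forall q x, q \in Q -> x \in M -> x \notin eps q /\ x \notin T (eps q)) ->
  #|C :|: M| <= 'C((t + d).+2, 2).
Proof.
move=> sQS core Qd CS MS p_inj pP pi_inj piP CM p_pi sparse epsP epsM.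
pose W := C :|: M; pose A0 v := if v \in C then p v else pi v.
have MC x : x \in M -> (x \in C) = false.
  by move=> xM; apply/negP=> /CM; rewrite xM.
have A0C c : c \in C -> A0 c = p c by rewrite /A0 => ->.
have A0M x : x \in M -> A0 x = pi x by rewrite /A0 => /MC ->.
have A0adj w : w \in W -> adj w (A0 w).
  by rewrite in_setU => /orP[wC|wM]; [rewrite A0C //; case: (pP w wC)|rewrite A0M //; apply: piP].
have A0E w : w \in W -> w |: A0 w \in E by move=> /A0adj/andP[].
have A0n w : w \in W -> w \notin A0 w by move=> /A0adj/andP[].
have A0c w : w \in W -> #|A0 w| = 2 by move=> /A0adj/adj_card.
have A0inj : {in W &, injective A0}.
  move=> x y; rewrite !in_setU => /orP[xC|xM] /orP[yC|yM].
  - by rewrite !A0C //; apply: p_inj.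
  - by rewrite (A0C _ xC) (A0M _ yM) => /eqP; rewrite (negbTE (p_pi _ _ xC yM)).
  - by rewrite (A0C _ yC) (A0M _ xM) => /esym/eqP; rewrite (negbTE (p_pi _ _ yC xM)).
  - by rewrite !A0M //; apply: pi_inj.
have pS c u : c \in C -> u \in p c -> (u \in S) /\ (u \notin Q).
  by move=> /pP[_ /subsetP s] /s; rewrite in_setD => /andP[].
have SW u : u \in S -> u \notin W.
  move=> uS; rewrite in_setU negb_or; apply/andP; split.
    by apply: contraL uS => /CS.
  by apply: contraL uS => /MS.
(* [W0] collects the vertices whose pair avoids [W]. Any other pair has a vertex [c] in [W]; then
   [w] is in [M] and, by sparseness, [c] is in [C]. Now the edge has at most one vertex in [S], so
   its third vertex is in [Q]. *)
pose W0 := [set w in W | A0 w \subset ~: W].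
have split1 w : exists qc : V * V, w \in W -> w \notin W0 ->
    [/\ w \in M, qc.1 \in Q, qc.2 \in C & A0 w = [set qc.1; qc.2]].
  have [wW|_] := boolP (w \in W); last by exists (w, w).
  have [_|] := boolP (w \in W0); first by exists (w, w).
  rewrite inE wW /= => /subsetPn[c cA]; rewrite in_setC negbK => cW.
  have wM : w \in M.
    by move: (wW); rewrite in_setU => /orP[wC|//]; move: (cW); rewrite A0C // in cA;
       have [uS _] := pS w c wC cA; rewrite (negbTE (SW c uS)).
  have cw : c != w by apply: contraTneq cA => ->; apply: A0n.
  have cC : c \in C.
    move: cW; rewrite in_setU => /orP[//|cM].
    have := sparse _ (A0E w wW); rewrite leqNgt => /negP[].
    have <- : #|[set c; w]| = 2 by rewrite cards2 cw.
    by apply: subset_leq_card; rewrite subUset !sub1set !in_setI !in_setU1 cA eqxx cM wM orbT.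
  have [/(core _ (A0E w wW))|] := boolP [disjoint w |: A0 w & Q].
    rewrite ltnNge => /negP[]; have cE := E3 (A0E w wW).
    have : (w |: A0 w) :&: S \subset (w |: A0 w) :\: [set c; w].
      apply/subsetP=> u; rewrite in_setI in_setD => /andP[-> uS]; rewrite andbT in_set2 negb_or.
      by apply/andP; split; apply: contraTneq uS => ->; [apply: CS|apply: MS].
    move/subset_leq_card => le; apply: leq_trans le _.
    rewrite cardsD cE (setIidPr _) ?cards2 ?cw //.
    by rewrite subUset !sub1set !in_setU1 cA eqxx orbT.
  rewrite -setI_eq0 => /set0Pn[q]; rewrite in_setI in_setU1 => /andP[qA qQ].
  have qS := subsetP sQS q qQ.
  have qw : q != w by apply: contraTneq qS => ->; apply: MS.
  have qc : q != c by apply: contraTneq qS => ->; apply: CS.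
  exists (q, c) => _ _; split=> //=; apply/esym/eqP; rewrite eqEcard A0c // cards2 qc.
  by rewrite subUset !sub1set cA andbT; move: qA; rewrite (negbTE qw) /= => ->.
have [qc qcP] := fin_all_exists split1.
pose K q := C :&: T (eps q).
have split2 q : exists rho : V -> V, q \in Q ->
  [/\ {in K q, forall c, rho c \notin T (eps q) :&: S}, {in K q &, injective rho},
      {in K q, forall c, rho c = c \/ rho c \in p c} &
      {in K q, forall c, exists2 v, v \in p c &
        v \in T (eps q) :&: S \/
        exists2 c', c' \in K q & index c' (enum (K q)) <= index c (enum (K q)) /\ rho c' = v}].
  have [qQ|_] := boolP (q \in Q); last by exists (fun x => x).
  have inK c : (c \in enum (K q)) = (c \in K q) by rewrite mem_enum.
  have KC c : c \in K q -> c \in C by rewrite in_setI => /andP[].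
  have [||||rho [r1 r2 r3 r4]] :=
    @greedy_representatives V (enum (K q)) p (T (eps q) :&: S).
  - exact: enum_uniq.
  - by move=> c; rewrite inK => /KC/CS cS; rewrite in_setI (negbTE cS) andbF.
  - move=> c c'; rewrite !inK => /KC/CS cS /KC c'C; apply/negP=> /(pS c' c c'C)[].
    by rewrite (negbTE cS).
  - by move=> c; rewrite inK => /KC/pP[/adj_card c2 _]; rewrite -card_gt0 c2.
  exists rho => _; split.
  - by move=> c; rewrite -inK => /r1.
  - by move=> c c'; rewrite -!inK; apply: r2.
  - by move=> c; rewrite -inK => /r3.
  - move=> c; rewrite -inK => /r4[v vc [vU|[c' c'K h]]]; exists v => //; first by left.
    by right; exists c'; rewrite -?inK.
have [rho rhoP] := fin_all_exists split2.
(* [T (eps q)] meets the edge [{w, q, c}], but neither in [w] nor in [q]. *)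
have cK w : w \in W -> w \notin W0 -> (qc w).2 \in K (qc w).1.
  move=> wW wW0; have [wM qQ cC Aw] := qcP w wW wW0.
  rewrite in_setI cC /=; have [eqE qeq] := epsP _ qQ.
  have [weq wT] := epsM _ _ qQ wM.
  have ne : w |: A0 w != eps (qc w).1.
    by apply: contraNneq weq => <-; rewrite setU11.
  have [u uT] := T_meets eqE (A0E w wW) ne.
  rewrite in_setU1 Aw in_set2 => /or3P[] /eqP E'; rewrite E' // in uT.
    by rewrite (negbTE wT) in uT.
  by rewrite (negbTE (T_avoids eqE qeq)) in uT.
pose ix w := index (qc w).2 (enum (K (qc w).1)).
pose A w := if w \in W0 then A0 w else [set (qc w).1; rho (qc w).1 (qc w).2].
pose key w := if w \in W0 then 0 else (ix w).+1.
pose alt (D : {set V}) (u v : V) := odflt v [pick z in D :\ u].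
(* The set must meet the pair [A0 v], which does not contain [v]; so [v] is replaced by a vertex of
   that pair, chosen outside [A0 w] for disjointness. *)
pose B0 w := (T (w |: A0 w) :\: W) :|:
  [set odflt v [pick z in A0 v :\: A0 w] | v in T (w |: A0 w) :&: W].
(* The second part, of fewer than [d] vertices, adds the vertices of [Q] other than [q] that
   [T (eps q)] lacks. With the first part, the third meets every [p c'] and contains the
   representatives preceding that of [c], while avoiding the latter. *)
pose B1 w := let q := (qc w).1 in let c := (qc w).2 in
  (T (eps q) :\: W) :|: ((Q :\: T (eps q)) :\ q) :|:
  [set (if index c' (enum (K q)) < index c (enum (K q)) then rho q c'
        else alt (p c') (rho q c) c') | c' in K q].
have altP c u v : c \in C -> alt (p c) u v \in p c /\ alt (p c) u v != u.
  move=> cC; rewrite /alt; case: pickP => [z|none] /=.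
    by rewrite in_setD1 => /andP[].
  have [/adj_card c2 _] := pP c cC; have := cardsD1 u (p c).
  rewrite c2 (_ : p c :\ u = set0) ?cards0; first by case: (u \in p c).
  by apply/setP=> z; rewrite [RHS]inE; apply: none.
have W0A w u : w \in W0 -> u \in A0 w -> u \notin W.
  by rewrite inE => /andP[_ /subsetP s] /s; rewrite in_setC.
have rhoQ w : w \in W -> w \notin W0 ->
    rho (qc w).1 (qc w).2 \notin Q.
  move=> wW wW0; have [wM qQ cC Aw] := qcP w wW wW0.
  have [_ _ /(_ _ (cK w wW wW0)) h _] := rhoP _ qQ.
  case: h => [->|]; last by move=> /(pS _ _ cC)[].
  by apply: contra (CS _ cC); apply: (subsetP sQS).
apply: (@skew_set_pairs V W A (fun w => if w \in W0 then B0 w else B1 w) key (t + d)).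
- move=> w wW; rewrite /A; case: ifPn => [wW0|wW0]; first exact: A0c.
  have [wM qQ cC Aw] := qcP w wW wW0.
  rewrite cards2; suff -> : (qc w).1 != rho (qc w).1 (qc w).2 by [].
  by apply: contraNneq (rhoQ w wW wW0) => <-.
- move=> w wW; case: ifPn => [wW0|wW0].
    rewrite /B0 cardsU; apply: leq_trans (leq_subr _ _) _.
    have := leq_imset_card (fun v => odflt v [pick z in A0 v :\: A0 w]) (T (w |: A0 w) :&: W).
    by have := card_T (A0E w wW); have := cardsID W (T (w |: A0 w)); lia.
  have [wM qQ cC Aw] := qcP w wW wW0; have [eqE qeq] := epsP _ qQ.
  rewrite /B1 /= cardsU; apply: leq_trans (leq_subr _ _) _.
  apply: (@leq_trans (#|T (eps (qc w).1) :\: W| + d + #|K (qc w).1|)).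
    apply: leq_add; last exact: leq_imset_card.
    rewrite cardsU; apply: leq_trans (leq_subr _ _) _; rewrite leq_add2l.
    by apply: leq_trans (ltnW (Qd _ eqE)); apply: subset_leq_card; apply: subD1set.
  have sK : #|K (qc w).1| <= #|T (eps (qc w).1) :&: W|.
    by apply: subset_leq_card; rewrite /K setIC; apply: setIS; apply: subsetUl.
  by move: sK (card_T eqE) (cardsID W (T (eps (qc w).1))); clear; lia.
- move=> w wW; rewrite /A; case: ifPn => [wW0|wW0]; apply/setP=> u; rewrite in_setI [RHS]inE;
    apply/negP=> /andP[].
    move=> uA; rewrite in_setU => /orP[|/imsetP[v]].
      rewrite in_setD => /andP[_]; apply/negP; apply: T_avoids; first exact: A0E.
      by rewrite in_setU1 uA orbT.
    rewrite in_setI => /andP[vT vW]; case: pickP => [z zP|none] /= E'.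
      by move: zP; rewrite in_setD -E' uA.
    by have := W0A w u wW0 uA; rewrite E' vW.
  have [wM qQ cC Aw] := qcP w wW wW0; have [eqE qeq] := epsP _ qQ.
  have cKw := cK w wW wW0; have rQ := rhoQ w wW wW0.
  have [r1 r2 r3 r4] := rhoP _ qQ.
  have qT : (qc w).1 \notin T (eps (qc w).1) by apply: T_avoids.
  have KC c : c \in K (qc w).1 -> c \in C by rewrite in_setI => /andP[].
  have qS := subsetP sQS _ qQ.
  rewrite in_set2 => /orP[] /eqP ->; rewrite !in_setU => /orP[/orP[]|/imsetP[c' c'K]].
  - by rewrite in_setD (negbTE qT) andbF.
  - by rewrite in_setD1 eqxx.
  - case: ifP => _ E'.
      case: (r3 c' c'K) => [E2|]; first by have := CS _ (KC _ c'K); rewrite -E2 -E' qS.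
      by rewrite -E' => /(pS _ _ (KC _ c'K))[_]; rewrite qQ.
    have [+ _] := altP c' (rho (qc w).1 (qc w).2) c' (KC _ c'K).
    by rewrite -E' => /(pS _ _ (KC _ c'K))[_]; rewrite qQ.
  - rewrite in_setD => /andP[rW rT]; have := r1 _ cKw; rewrite in_setI rT /=.
    case: (r3 _ cKw) => [E'|/(pS _ _ cC)[->]//].
    by rewrite E' in_setU cC in rW.
  - by rewrite in_setD1 in_setD (negbTE rQ) !andbF.
  - case: ifP => [lt|_] E'.
      by have := r2 _ _ cKw c'K E' => E2; rewrite E2 ltnn in lt.
    by have [_] := altP c' (rho (qc w).1 (qc w).2) c' (KC _ c'K); rewrite -E' eqxx.
(* [key] excludes the case of [x] outside and [y] inside [W0]. *)
move=> x y xW yW xy; rewrite /key /A; case: ifPn => [xW0|xW0]; case: ifPn => [yW0|yW0] // le.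
- have ne : x |: A0 x != y |: A0 y.
    apply: contraNneq xy => E'; have : x \in y |: A0 y by rewrite -E' setU11.
    by rewrite in_setU1 => /orP[//|/(W0A y x yW0)]; rewrite xW.
  have [v vT] := T_meets (A0E y yW) (A0E x xW) ne.
  rewrite in_setU1 => /orP[/eqP E'|vA].
    apply/set0Pn; pose z := odflt x [pick z in A0 x :\: A0 y].
    (* Distinct pairs of equal size: [A0 x] is not contained in [A0 y]. *)
    have [z0 z0P] : exists z0, z0 \in A0 x :\: A0 y.
      apply/set0Pn; rewrite setD_eq0; apply: contra xy => sub.
      have : A0 x == A0 y by rewrite eqEcard sub !A0c.
      by move/eqP/A0inj => -> //.
    exists z; rewrite in_setI in_setU.
    have -> : z \in A0 x.
      rewrite /z; case: pickP => [z1|/(_ z0)]; last by rewrite z0P.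
      by rewrite in_setD => /andP[].
    apply/orP; right; apply/imsetP; exists x => //.
    by rewrite in_setI xW -E' vT.
  apply/set0Pn; exists v; rewrite in_setI vA in_setU in_setD vT.
  by rewrite (W0A x v xW0 vA).
- have [yM qQ cC Ay] := qcP y yW yW0; have [eqE qeq] := epsP _ qQ.
  have [r1 r2 r3 r4] := rhoP _ qQ.
  have ne : x |: A0 x != eps (qc y).1.
    move: (xW); rewrite in_setU => /orP[xC|xM]; last first.
      by have [nx _] := epsM _ _ qQ xM; apply: contraNneq nx => <-; rewrite setU11.
    apply: contraTneq qeq => <-; rewrite in_setU1 negb_or A0C //; apply/andP; split.
      by apply: contraTneq (subsetP sQS _ qQ) => ->; apply: CS.
    by apply/negP=> /(pS _ _ xC)[_]; rewrite qQ.
  have [v vT] := T_meets eqE (A0E x xW) ne.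
  rewrite in_setU1 => /orP[/eqP E'|vA]; last first.
    apply/set0Pn; exists v; rewrite in_setI vA !in_setU in_setD vT.
    by rewrite (W0A x v xW0 vA).
  have xC : x \in C.
    move: (xW); rewrite in_setU => /orP[//|xM].
    by have [_] := epsM _ _ qQ xM; rewrite -E' vT.
  have xK : x \in K (qc y).1 by rewrite in_setI xC -E'.
  rewrite A0C //; apply/set0Pn.
  (* If [x] precedes [c], then [p x] is met by [T (eps q)] or by a representative chosen no later
     than that of [x]; otherwise [alt] meets it. *)
  have [lt|ge] := ltnP (index x (enum (K (qc y).1))) (index (qc y).2 (enum (K (qc y).1))).
    have [u ux [uTS|[c' c'K [le' E2]]]] := r4 x xK; exists u; rewrite in_setI ux !in_setU.
      by move: uTS; rewrite in_setI => /andP[uT uS]; rewrite in_setD uT (SW u uS).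
    apply/orP; right; apply/imsetP; exists c' => //.
    by rewrite (leq_ltn_trans le' lt) E2.
  exists (alt (p x) (rho (qc y).1 (qc y).2) x).
  rewrite in_setI; have [-> _] := altP x (rho (qc y).1 (qc y).2) x xC.
  rewrite !in_setU; apply/orP; right; apply/imsetP; exists x => //.
  by rewrite ltnNge ge.
have [xM qxQ cxC Ax] := qcP x xW xW0.
have [yM qQ cC Ay] := qcP y yW yW0; apply/set0Pn.
(* [B1 y] contains every vertex of [Q] but its own [q]. For a common [q], the representative for [x]
   comes strictly earlier, as equal positions would give equal pairs. *)
have [E'|nq] := eqVneq (qc x).1 (qc y).1; last first.
  exists (qc x).1; rewrite in_setI in_set2 eqxx /= !in_setU.
  rewrite [_ \in _ :\ _]in_setD1 nq !in_setD qxQ SW ?(subsetP sQS) //=.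
  by case: (_ \in T _).
exists (rho (qc x).1 (qc x).2); rewrite in_setI in_set2 eqxx orbT /= !in_setU.
apply/orP; right; apply/imsetP; exists (qc x).2; first by rewrite -E'; apply: cK.
rewrite -E' ifT //.
have xK := cK x xW xW0; have yK := cK y yW yW0; rewrite -E' in yK.
move: le; rewrite /ix ltnS -E' leq_eqVlt => /orP[/eqP eq_ix|//].
have E2 : (qc x).2 = (qc y).2.
  by rewrite -[LHS](nth_index x (s := enum (K (qc x).1))) ?mem_enum // eq_ix nth_index ?mem_enum.
by case/eqP: xy; apply: A0inj => //; rewrite Ax Ay E' E2.
Qed.

(** The four terms count the core [S], the unmatched remainder, the vertices removed from [N] and
    the matched vertices. *)
Lemma order_bound d : 0 < d -> exists s r y w,
  [/\ #|V| <= s + r + y + w, s * d <= t * d + (t + 2) * t, d * r <= w,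
      y <= t * (d * d + 3 * d + 3) & w <= 'C((t + d).+2, 2)].
Proof.
move=> d0; have [S [Q [sQS Qt cS core Qd]]] := separating_core d0.
pose G : {set {set V}} := [set g : {set V} | (g \subset S :\: Q) && [exists x in ~: S, adj x g]].
have [C [N [P [p [[sC sN dCN sP] [p_inj pP] toP expand cR]]]]] :=
  expander_split adj (~: S) G set0 d.
have [eps epsE epsP] := fin_all_exists2 covE.
have NS x : x \in N -> x \notin S by move/(subsetP sN); rewrite in_setC.
have CS x : x \in C -> x \notin S by move/(subsetP sC); rewrite in_setC.
have toP' x (g : {set V}) : x \in N -> g \subset S :\: Q -> adj x g -> g \in P.
  move=> xN gS xg; apply: (toP x) => //; rewrite inE gS /=; apply/existsP; exists x.
  by rewrite (subsetP sN).
have P0 (g : {set V}) : g \in P -> g != set0.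
  move=> /(subsetP sP); rewrite inE => /andP[_ /existsP[x /andP[_ /adj_card g2]]].
  by rewrite -card_gt0 g2.
have dNS : [disjoint N & S] by rewrite disjoints_subset.
have few q : #|T (eps q) :&: N| <= d * d + 3 * d.
  by apply: (few_in_expanding_part dNS sQS core toP' P0 expand) => //; apply: Qd.
(* Removing these vertices makes [eps q] and [T (eps q)] avoid [M] for all [q] in [Q]; both
   sparseness and the final count rely on this. *)
pose F q := N :&: (T (eps q) :|: eps q).
pose Y := \bigcup_(q in Q) F q; pose M := N :\: Y.
have MN x : x \in M -> x \in N by rewrite in_setD => /andP[].
have cY : #|Y| <= t * (d * d + 3 * d + 3).
  apply: (@leq_trans (#|Q| * (d * d + 3 * d + 3))); last by rewrite leq_mul2r Qt orbT.
  apply: card_bigcup_le => q _; rewrite /F setIUr cardsU; apply: leq_trans (leq_subr _ _) _.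
  apply: leq_add; first by rewrite setIC.
  by rewrite -(E3 (epsE q)); apply: subset_leq_card; apply: subsetIr.
have epsM q x : q \in Q -> x \in M -> x \notin eps q /\ x \notin T (eps q).
  move=> qQ; rewrite in_setD => /andP[xY xN].
  split; apply: contra xY => xe; apply/bigcupP; exists q => //; rewrite in_setI xN in_setU xe //.
  by rewrite orbT.
(* An edge with two vertices in [M] has at most one in [S], so it meets [Q] in some [q]; then
   [T (eps q)] would have to meet it in a fourth vertex. *)
have sparse : {in E, forall e : {set V}, #|e :&: M| <= 1}.
  move=> e eE; rewrite leqNgt; apply/negP => /card_gt1P[x [y []]].
  rewrite !in_setI => /andP[xe xM] /andP[ye yM] xy.
  have xyS : [set x; y] \subset e :\: S.
    by rewrite subUset !sub1set !in_setD xe ye !NS ?MN.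
  have := subset_leq_card xyS; rewrite cards2 xy cardsD E3 // => le.
  have [/(core e eE)|] := boolP [disjoint e & Q]; first by move: le; clear; lia.
  rewrite -setI_eq0 => /set0Pn[q]; rewrite in_setI => /andP[qe qQ].
  have [xq xT] := epsM q x qQ xM; have [_ yT] := epsM q y qQ yM.
  have ne : e != eps q by apply: contraNneq xq => <-.
  have [v vT ve] := T_meets (epsE q) eE ne.
  have vq : v != q by apply: contraTneq vT => ->; apply: T_avoids.
  have vx : v != x by apply: contraTneq vT => ->.
  have vy : v != y by apply: contraTneq vT => ->.
  have qS := subsetP sQS q qQ.
  have qx : q != x by apply: contraTneq qS => ->; apply/NS/MN.
  have qy : q != y by apply: contraTneq qS => ->; apply/NS/MN.
  have := cardsD1 v e; have := cardsD1 q (e :\ v); have := cardsD1 x (e :\ v :\ q).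
  have := cardsD1 y (e :\ v :\ q :\ x); rewrite !in_setD1 ve qe xe ye (E3 eE).
  rewrite [x == q]eq_sym [y == q]eq_sym [y == x]eq_sym [q == v]eq_sym [x == v]eq_sym [y == v]eq_sym.
  by rewrite vq vx vy qx qy xy; clear; lia.
have [pi [pi_inj piP]] := sparse_matching sparse.
exists #|S|, #|~: S :\: (C :|: N)|, #|Y|, #|C :|: M|; split=> //.
- have <- : #|S| + #|~: S| = #|V| by rewrite cardsC.
  have : ~: S \subset (~: S :\: (C :|: N)) :|: (Y :|: (C :|: M)).
    apply/subsetP=> x xS; rewrite !in_setU in_setD xS in_setU in_setD.
    by case: (x \in C); case: (x \in N); case: (x \in Y).
  by move/subset_leq_card; rewrite !cardsU; lia.
- by rewrite (leq_trans cR) // subset_leq_card // subsetUl.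
apply: (@two_level_count d S Q C M p pi eps) => //.
- by move=> x /MN/NS.
- by move=> c /pP[cp]; rewrite inE => /andP[].
- move=> c cC; rewrite in_setD negb_and; apply/orP; right.
  by apply/negP=> cN; have /pred0P/(_ c) := dCN; rewrite /= cC cN.
(* [p c] is outside [P], whereas a pair in [S :\: Q] adjacent to a vertex of [N] is in [P]. *)
move=> c x cC xM; apply/eqP=> eq_pc; have [_] := pP c cC.
rewrite inE => /andP[pcS _] /negP; apply; apply: (toP' x) => //; first exact: MN.
by rewrite eq_pc; apply: piP.
Qed.
End Critical.

Require Import Defs.
From Stdlib Require Import Reals Lra.

(** * Transversal numbers and the final estimate *)

Lemma transversalP (V : finType) (E : {set {set V}}) (U : {set V}) :
  reflect {in E, forall e : {set V}, exists2 v, v \in U & v \in e} (transversal E U).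
Proof.
apply: (iffP forall_inP) => h e eE.
  by have /set0Pn[v] := h e eE; rewrite in_setI => /andP[vU ve]; exists v.
by have [v vU ve] := h e eE; apply/set0Pn; exists v; rewrite in_setI vU.
Qed.

Lemma tau_le (V : finType) (E : {set {set V}}) (U : {set V}) :
  transversal E U -> tau E <= #|U|.
Proof.
rewrite /tau => tU; have : U \in index_enum {set V} by apply: mem_index_enum.
elim: (index_enum _) => //= W s IH; rewrite inE big_cons.
case/orP => [/eqP <-|/IH le]; first by rewrite tU geq_minl.
by case: ifP => // _; apply: leq_trans (geq_minr _ _) le.
Qed.

(** The strict bound excludes the default value of the minimum. *)
Lemma tau_attained (V : finType) (E : {set {set V}}) :
  tau E < #|V| -> exists2 U, transversal E U & #|U| = tau E.
Proof.
suff [->|[U tU <-]] : tau E = #|V| \/ (exists2 U, transversal E U & #|U| = tau E).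
- by rewrite ltnn.
- by exists U.
rewrite /tau; elim/big_ind: _ => [|m n hm hn|U tU]; first by left.
  by rewrite /minn; case: ifP.
by right; exists U.
Qed.

Lemma bin_INR n : (INR 'C(n.+2, 2) * 2 = (INR n + 2) * (INR n + 1))%R.
Proof.
have := bin_ffact n.+2 2; rewrite !ffactnS ffactn0 muln1 /= => /(congr1 INR).
rewrite -multE !mult_INR !S_INR /=; lra.
Qed.

Lemma cube_root_nat t : 0 < t -> exists d, [/\ 0 < d, t <= d * d * d & d * d * d <= 8 * t].
Proof.
move=> t0; have ex : exists d, t <= d * d * d by exists t; rewrite -mulnA leq_pmulr // muln_gt0 t0.
case: (ex_minnP ex) => -[|d] td dmin; first by lia.
exists d.+1; split=> //.
(* Minimality puts the cube of the predecessor [d] below [t]; for positive [d], [d.+1 <= 2 * d]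
   gives the factor 8. *)
have : d * d * d < t by rewrite ltnNge; apply/negP=> /dmin; rewrite ltnn.
case: d {dmin td} => [|d] lt; first by lia.
have le : d.+2 <= 2 * d.+1 by lia.
have := leq_mul (leq_mul le le) le; lia.
Qed.

Lemma cube_le a b : (0 <= a -> 0 <= b -> a * a * a <= b * b * b -> a <= b)%R.
Proof.
move=> a0 b0 le; apply: Rnot_lt_le => lt.
have : (0 < (a - b) * (a * a + a * b + b * b))%R by apply: Rmult_lt_0_compat; nra.
lra.
Qed.

Lemma order_estimate t d s r y w n :
    0 < t -> 0 < d -> t <= d * d * d -> d * d * d <= 8 * t ->
    n <= s + r + y + w -> s * d <= t * d + (t + 2) * t -> d * r <= w ->
    y <= t * (d * d + 3 * d + 3) -> w <= 'C((t + d).+2, 2) ->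
  (INR n <= INR 'C(t + 2, 2) + 40 * Rpower (INR t) (5 / 3))%R.
Proof.
move=> t0 d0 td dt hn hs hr hy hw.
have t1 : (1 <= INR t)%R by apply: (le_INR 1); apply/leP.
(* With [x] the cube root of [t], [d] lies between [x] and [2 * x]. The excess over the binomial is
   at most [x^3 + 3 x^5] from [s], [10 x^5] from [r], [13 x^5] from [y] and [2 x^4 + 2 x^2 + 3 x]
   from [w]; as [x >= 1], the total is at most [34 x^5]. *)
pose x := Rpower (INR t) (1 / 3).
have x0 : (0 < x)%R by apply: exp_pos.
have xn k : Rpower (INR t) (INR k / 3) = (x ^ k)%R.
  rewrite -Rpower_pow // /x Rpower_mult; congr Rpower; lra.
have x3 : (x ^ 3 = INR t)%R.
  rewrite -xn (_ : INR 3 / 3 = 1)%R ?Rpower_1 //; [lra|rewrite /=; lra].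
have x5 : (Rpower (INR t) (5 / 3) = x ^ 5)%R.
  by rewrite -xn; congr Rpower; rewrite /=; lra.
rewrite x5.
have toR a b : a <= b -> (INR a <= INR b)%R by move/leP/le_INR.
have {}td := toR _ _ td; have {}dt := toR _ _ dt; have {}hn := toR _ _ hn.
have {}hs := toR _ _ hs; have {}hr := toR _ _ hr; have {}hy := toR _ _ hy.
have {}hw := toR _ _ hw.
have := bin_INR (t + d); have := bin_INR t; rewrite -[t.+2]addn2.
move: hw; move: (INR 'C((t + d).+2, 2)) (INR 'C(t + 2, 2)) => b' b hw hb.
have i8 : INR 8 = 8%R by rewrite /=; lra.
have i3 : INR 3 = 3%R by rewrite /=; lra.
have i2 : INR 2 = 2%R by rewrite /=; lra.
move: td dt hn hs hr hy; rewrite -multE -plusE !(plus_INR, mult_INR) i8 i3 i2.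
have D1 : (1 <= INR d)%R by apply: (le_INR 1); apply/leP.
move: hw hb; have := pos_INR r; have := pos_INR s; have := pos_INR w; move: D1 t1; rewrite -x3.
move: (INR n) (INR s) (INR r) (INR y) (INR w) (INR d).
clear -x0 => n' s' r' y' w' D D1 t1 w0 s0 r0 hw hb td dt hn hs hr hy hb'.
have x1 : (1 <= x)%R by apply: cube_le; lra.
have xD : (x <= D)%R by apply: cube_le; lra.
have Dx : (D <= 2 * x)%R by apply: cube_le; lra.
have up k : (x ^ k <= x ^ k.+1)%R by have := pow_le x k; rewrite /=; nra.
have := up 0; have := up 1; have := up 2; have := up 3; have := up 4 => u4 u3 u2 u1 u0.
have s_le : (s' <= x ^ 3 + 3 * x ^ 5)%R.
  apply: Rnot_lt_le => lt.
  have : (3 * x ^ 5 * x < (s' - x ^ 3) * x)%R by apply: Rmult_lt_compat_r; lra.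
  have : ((s' - x ^ 3) * x <= (s' - x ^ 3) * D)%R by apply: Rmult_le_compat_l; lra.
  have : (x ^ 3 <= x ^ 3 * x ^ 3)%R by nra.
  rewrite /= in hs *; lra.
have b'_le : (b' <= 10 * (x ^ 5 * x))%R.
  have : ((x ^ 3 + D + 2) * (x ^ 3 + D + 1) <= (5 * x ^ 3) * (4 * x ^ 3))%R.
    by apply: Rmult_le_compat; rewrite /= in u0 u1 u2 *; lra.
  rewrite /= in hb' *; lra.
have r_le : (r' <= 10 * x ^ 5)%R.
  apply: Rnot_lt_le => lt.
  have : (10 * x ^ 5 * x < r' * x)%R by apply: Rmult_lt_compat_r; lra.
  have : (r' * x <= r' * D)%R by apply: Rmult_le_compat_l; lra.
  lra.
have DD : (D * D <= 4 * x ^ 2)%R by rewrite /=; nra.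
have y_le : (x ^ 3 * (D * D + 3 * D + 3) <= x ^ 3 * (13 * x ^ 2))%R.
  by apply: Rmult_le_compat_l; rewrite /= in u0 u1 DD *; lra.
have Dx3 : (D * x ^ 3 <= 2 * x ^ 4)%R by rewrite /= in u0 *; nra.
rewrite /= in u0 u1 u2 u3 u4 y_le s_le r_le hb hb' hy DD Dx3 *; lra.
Qed.

Theorem theorem1 :
  exists f : nat -> R,
    (exists (C : R) (N : nat), forall t : nat, (N <= t)%nat ->
        Rabs (f t) <= C * Rpower (INR t) (5 / 3))%R /\
    (forall (t : nat) (V : finType) (E : {set {set V}}),
        uniform3 E -> no_isolated E -> tau_critical E -> tau E = t ->
        (INR #|V| <= INR 'C(t + 2, 2) + f t)%R).
Proof.
exists (fun t => 40 * Rpower (INR t) (5 / 3))%R; split.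
  exists 40%R, 0 => t _; have := exp_pos (5 / 3 * ln (INR t)) => pos.
  rewrite Rabs_pos_eq; rewrite /Rpower; lra.
move=> t V E E3 cov crit tauE.
have [->|/card_gt0P[v0 _]] := posnP #|V|.
  have := exp_pos (5 / 3 * ln (INR t)); have := pos_INR 'C(t + 2, 2).
  by rewrite /Rpower /= => ? ?; lra.
have tau_V : tau E <= #|V|.
  rewrite -cardsT; apply: tau_le; apply/transversalP => e eE.
  have /card_gt0P[v ve] : 0 < #|e| by rewrite E3.
  by exists v.
have [T0 T0_meets cT0] :
    exists2 T0 : {set V}, {in E, forall e : {set V}, exists2 v, v \in T0 & v \in e} & #|T0| <= t.
  (* When [tau E = #|V|], the whole vertex set serves as [T0]. *)
  move: tau_V; rewrite leq_eqVlt => /orP[/eqP eqV|/tau_attained[U /transversalP tU cU]].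
    exists [set: V]; last by rewrite cardsT -eqV tauE.
    move=> e eE; have /card_gt0P[v ve] : 0 < #|e| by rewrite E3.
    by exists v.
  by exists U; rewrite // cU tauE.
have exT (e : {set V}) : exists U : {set V}, e \in E -> transversal (E :\ e) U /\ #|U| < t.
  have [eE|_] := boolP (e \in E); last by exists set0.
  have lt := crit e eE; have [U tU cU] := tau_attained (leq_trans lt tau_V).
  by exists U; rewrite cU -tauE.
have [T TP] := fin_all_exists exT.
have card_T : {in E, forall e : {set V}, #|T e| < t} by move=> e /TP[].
have T_meets : {in E &, forall e f : {set V}, f != e -> exists2 v, v \in T e & v \in f}.
  by move=> e f /TP[/transversalP tT _] fE fe; apply: tT; rewrite in_setD1 fe.
have t_min (U : {set V}) :
    {in E, forall e : {set V}, exists2 v, v \in U & v \in e} -> t <= #|U|.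
  by move=> /transversalP/tau_le; rewrite tauE.
(* Otherwise [T e] would be a transversal of [E] with fewer than [t] vertices. *)
have T_avoids : {in E, forall (e : {set V}) v, v \in e -> v \notin T e}.
  move=> e eE v ve; apply/negP => vT; have := card_T e eE; rewrite ltnNge => /negP; apply.
  apply: t_min => f fE; have [->|fe] := eqVneq f e; first by exists v.
  exact: T_meets.
have t0 : 0 < t by have [e eE _] := cov v0; apply: leq_ltn_trans (card_T e eE).
have [d [d0 td dt]] := cube_root_nat t0.
have [s [r [y [w [hn hs hr hy hw]]]]] :=
  order_bound E3 cov card_T T_meets T_avoids t_min cT0 T0_meets d0.
exact: order_estimate t0 d0 td dt hn hs hr hy hw.
Qed.
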